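(* Let $k$ be an algebraically closed field, let $d,m\ge1$ be integers, let $k[u]$ be the polynomial ring in the $N+1=dm$ indeterminates $u=(u_{ij}\mid 1\le i\le d,\,1\le j\le m)$, and let $V\subset\mathbb{P}^N_k$ be a projective variety. Let $E$ be a graded submodule of the free module $F=k[u]^h$, $h\ge1$, generated by $g_1,\ldots,g_s$, and for $t\ge0$ let $I_t$ be the ideal of $k[u]$ generated by the $t$-minors of the $h\times s$ matrix of the coordinates of $g_1,\ldots,g_s$. Let $J$ be an ideal of $k[u]$ such that $\sqrt{J}$ is the defining ideal of $V$. Then $$\operatorname{core}_V(E)=\bigcap_{t\ge1}\big[\big(E+\sqrt{I_t}F\big):JI_{t-1}\big]\cap k^h.$$
   Context: Elements of $E$ are regarded as vectors of $h$ polynomials in $k[u]$. For $\alpha\in\mathbb{P}^N_k$, $E_\alpha\subseteq k^h$ denotes the $k$-vector space generated by all vectors obtained from vectors of $E$ by the substitution of $u$ by $\alpha$ (since $E$ is graded this does not depend on the choice of homogeneous coordinates of $\alpha$). Define $$\operatorname{core}_V(E):=\bigcap_{\alpha\in\mathbb{P}^N_k\setminus V}E_\alpha\subseteq k^h.$$ Here ''projective variety'' means a Zariski closed subset of projective space, not necessarily irreducible, and its defining ideal is the ideal of polynomials vanishing on its affine cone in $k^{N+1}$ (the cone including the origin, so that the defining ideal of $\emptyset$ is the irrelevant ideal generated by the $u_{ij}$). By convention $I_0=k[u]$ and $I_t=0$ if $t>\min(h,s)$. The colon $(E+\sqrt{I_t}F):JI_{t-1}$ denotes the set of $f\in F$ with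 $JI_{t-1}f\subseteq E+\sqrt{I_t}F$, and $k^h\subseteq k[u]^h$ is the set of constant vectors. *)

(* Defs.v *)
From HB Require Import structures.
From mathcomp Require Import all_boot all_order all_algebra.
From mathcomp Require Export mpoly.

Set Implicit Arguments.
Unset Strict Implicit.
Unset Printing Implicit Defensive.

Import GRing.Theory.
Local Open Scope ring_scope.

Definition lin_span (R : pzRingType) (M : lmodType R) (S : M -> Prop) (x : M) : Prop :=
  exists (r : nat) (c : 'I_r -> R) (v : 'I_r -> M),
    (forall i, S (v i)) /\ x = \sum_i c i *: v i.

Definition is_ideal (A : comNzRingType) (I : A -> Prop) : Prop :=
  [/\ I 0, (forall a b, I a -> I b -> I (a + b))
    & (forall a b, I b -> I (a * b))].

(* The regular module A^o makes spans in A itself ideals. *)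
Definition ideal_gen (A : comNzRingType) (S : A -> Prop) : A -> Prop :=
  @lin_span A A^o S.

Definition radical (A : comNzRingType) (I : A -> Prop) (a : A) : Prop :=
  exists e : nat, I (a ^+ e).

Definition ideal_mul (A : comNzRingType) (I J : A -> Prop) : A -> Prop :=
  ideal_gen (fun x => exists a b, [/\ I a, J b & x = a * b]).

Definition ideal_smul (A : comNzRingType) (M : lmodType A)
    (I : A -> Prop) (S : M -> Prop) : M -> Prop :=
  lin_span (fun x => exists a f, [/\ I a, S f & x = a *: f]).

Definition submod_add (A : comNzRingType) (M : lmodType A)
    (S T : M -> Prop) (x : M) : Prop :=
  exists y z, [/\ S y, T z & x = y + z].

Definition colon (A : comNzRingType) (M : lmodType A)
    (S : M -> Prop) (I : A -> Prop) (f : M) : Prop :=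
  forall a, I a -> S (a *: f).

Definition whole (M : Type) : M -> Prop := fun=> True.

(* For t = 0 the only minor is the empty determinant 1, and there is no minor *)
(* when t exceeds h or s; hence I_0 = A and I_t = 0 for t > min(h, s).        *)
Definition is_minor (A : comNzRingType) (h s t : nat) (G : 'M[A]_(h, s))
    (a : A) : Prop :=
  exists (f : 'I_t -> 'I_h) (g : 'I_t -> 'I_s),
    [/\ {homo f : i j / (i < j)%N}, {homo g : i j / (i < j)%N}
      & a = \det (mxsub f g G)].

Definition minor_ideal (A : comNzRingType) (h s : nat) (G : 'M[A]_(h, s))
    (t : nat) : A -> Prop :=
  ideal_gen (is_minor t G).

Section Core.

Variables (k : closedFieldType) (n : nat).

(* A point of P^(n-1) is given by homogeneous coordinates a : 'rV[k]_n, a != 0,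
   and a subset of P^(n-1) by a predicate on such a; its value at a = 0 is
   never used.  For n = d * m the indeterminate u_ij is
   'X_(mxvec_index i j). *)

(* Being cut out by homogeneous polynomials makes V invariant under scaling. *)
Definition projective_variety (V : 'rV[k]_n -> Prop) : Prop :=
  exists S : {mpoly k[n]} -> Prop,
    (forall p, S p -> p \is homog mdeg) /\
    (forall a, a != 0 -> (V a <-> forall p, S p -> p.@[a 0] = 0)).

Definition affine_cone (V : 'rV[k]_n -> Prop) (a : 'rV[k]_n) : Prop :=
  a = 0 \/ (a != 0 /\ V a).

Definition defining_ideal (V : 'rV[k]_n -> Prop) (p : {mpoly k[n]}) : Prop :=
  forall a, affine_cone V a -> p.@[a 0] = 0.

Variable h : nat.

Definition subst_vec (f : 'cV[{mpoly k[n]}]_h) (a : 'rV[k]_n) : 'cV[k]_h :=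
  map_mx (fun p => p.@[a 0]) f.

Definition const_vec (c : 'cV[k]_h) : 'cV[{mpoly k[n]}]_h :=
  map_mx (fun x => x%:MP) c.

(* All basis vectors of k[u]^h have degree 0. *)
Definition graded (E : 'cV[{mpoly k[n]}]_h -> Prop) : Prop :=
  forall f e, E f -> E (map_mx (pihomog mdeg e) f).

Definition fiber (E : 'cV[{mpoly k[n]}]_h -> Prop) (a : 'rV[k]_n) :
    'cV[k]_h -> Prop :=
  lin_span (fun w => exists f, E f /\ w = subst_vec f a).

Definition core (V : 'rV[k]_n -> Prop) (E : 'cV[{mpoly k[n]}]_h -> Prop)
    (c : 'cV[k]_h) : Prop :=
  forall a, a != 0 -> ~ V a -> fiber E a c.

End Core.

(* Main.v *)
Require Import Defs.
From HB Require Import structures.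
From mathcomp Require Import all_boot all_order all_algebra.
From mathcomp Require Import fingroup perm mpoly.
From mathcomp Require boolp classical_sets.

Set Implicit Arguments.
Unset Strict Implicit.
Unset Printing Implicit Defensive.

Import GRing.Theory.
Local Open Scope ring_scope.

(** Let G be the matrix with columns g_1, ..., g_s, so that E is the column
    module of G and E_a is the column space of the evaluated matrix G(a).

    From the colon conditions to the core.  Fix a point a outside V and let t
    be such that some t-minor delta of G does not vanish at a, while all
    (t+1)-minors do.  Since sqrt J is the defining ideal of V, some q in J has
    q(a) <> 0.  The condition for t + 1 puts q delta c in E + sqrt(I_(t+1)) F;
    evaluating at a kills the second summand, so q(a) delta(a) c lies in E_a,
    hence c does.  This needs no notion of rank ([exists_last_minor]).

    From the core to the colon conditions.  It suffices to treat q delta c with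
    q in J and delta a t-minor.  Cramer's rule provides a square matrix K
    ([cramer_mx]) such that K x is congruent to delta x modulo the columns of
    G, and such that the entries of K G are (t+1)-minors of G, namely those
    bordering delta.  So it is enough that the entries of q K c lie in
    sqrt(I_(t+1)), and by the Nullstellensatz that they vanish wherever
    I_(t+1) does.  On the cone over V, origin included, q vanishes.  Outside it
    c = G(a) w for some w, because c is in the core, and so
    K(a) c = (K G)(a) w = 0.

    The Nullstellensatz is proved in the form: if P is a prime ideal of
    k[x_1..x_n] and f is not in P, then P has a zero at which f does not vanish.
    The induction on n removes one variable at a time: for P prime in A[X] and
    f outside P there is a single element a of A, outside P, such that every
    homomorphism from A to k that kills the contraction of P but not a extends
    to A[X] by a value of X that kills P but not f ([prime_extension]).  An
    ideal whose radical omits f is contained in a prime ideal omitting f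
    ([exists_prime_avoiding]), which gives the usual statement. *)

(** * Prime ideals avoiding an element *)

Definition prime_ideal (A : comNzRingType) (P : A -> Prop) : Prop :=
  [/\ is_ideal P, ~ P 1 & forall a b, P (a * b) -> P a \/ P b].

Section Ideals.

Variable A : comNzRingType.
Implicit Types (I P : A -> Prop) (a b f : A).

Lemma idealMr I a b : is_ideal I -> I a -> I (a * b).
Proof. by case=> _ _ IM Ia; rewrite mulrC; apply: IM. Qed.

Lemma idealN I a : is_ideal I -> I a -> I (- a).
Proof. by case=> _ _ IM Ia; rewrite -mulN1r; apply: IM. Qed.

Lemma idealB I a b : is_ideal I -> I a -> I b -> I (a - b).
Proof. by move=> Ii Ia Ib; case: (Ii) => _ ID _; apply: ID => //; apply: idealN. Qed.

Lemma idealBl I a b : is_ideal I -> I b -> I (a - b) -> I a.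
Proof. by case=> _ ID _ Ib Iab; rewrite -(subrK b a); apply: ID. Qed.

Lemma ideal_sum I (J : finType) (F : J -> A) :
  is_ideal I -> (forall j, I (F j)) -> I (\sum_j F j).
Proof. by case=> I0 ID _ IF; apply: (big_ind I). Qed.

Lemma prime_idealX P a e : prime_ideal P -> P (a ^+ e) -> P a.
Proof.
case=> _ P1 PM; elim: e => [|e IHe]; first by rewrite expr0 => /P1.
by rewrite exprS => /PM [].
Qed.

Definition adjoin I f (a : A) : Prop := exists x b, I x /\ a = x + b * f.

Lemma adjoin_ideal I f : is_ideal I -> is_ideal (adjoin I f).
Proof.
case=> I0 ID IM; split.
- by exists 0, 0; split; rewrite // mul0r addr0.
- move=> _ _ [x [b [Ix ->]]] [y [c [Iy ->]]].
  by exists (x + y), (b + c); split; [apply: ID | rewrite mulrDl addrACA].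
- move=> a _ [x [b [Ix ->]]].
  by exists (a * x), (a * b); split; [apply: IM | rewrite mulrDr mulrA].
Qed.

Lemma sub_adjoin I f a : I a -> adjoin I f a.
Proof. by exists a, 0; split; rewrite // mul0r addr0. Qed.

Lemma mem_adjoin I f : is_ideal I -> adjoin I f f.
Proof. by case=> I0 _ _; exists 0, 1; split; rewrite // mul1r add0r. Qed.

(** An ideal containing I and maximal among those that contain no power of f is
    prime: if a and b are both outside it, adjoining either one brings in a
    power of f, and the product of these two powers lies in the ideal as soon as
    a b does. *)
Lemma exists_prime_avoiding I f : is_ideal I -> ~ radical I f ->
  exists P, [/\ prime_ideal P, forall a, I a -> P a & ~ P f].
Proof.
(* Ordering the sets X by their unions with I makes the empty chain harmless:
   its upper bound, the empty set, stands for I itself. *)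
move=> Ii If; pose U (X : A -> Prop) (a : A) := X a \/ I a.
pose Q X := is_ideal (U X) /\ forall e, ~ U X (f ^+ e).
have [F FQ Ftot|X [[Ui Uf] Xmax]] := @classical_sets.Zorn_bigcup A Q.
  have UX X a : F X -> U X a -> U (classical_sets.bigcup F id) a.
    by move=> FX [Xa|Ia]; [left; exists X | right].
  have UF a : U (classical_sets.bigcup F id) a -> I a \/ exists2 X, F X & U X a.
    by case=> [[X FX Xa]|Ia]; [right; exists X; last left | left].
  split; last first.
    move=> e /UF [Ie|[X FX]]; first by apply: If; exists e.
    by case: (FQ X FX) => _; apply.
  split.
  - by right; case: Ii.
  - move=> a b /UF [Ia|[X FX Xa]] /UF [Ib|[Y FY Yb]].
    + by right; case: Ii => _ ID _; apply: ID.
    + apply: (UX Y) => //; case: (FQ Y FY) => [[_ UD _] _].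
      by apply: UD => //; right.
    + apply: (UX X) => //; case: (FQ X FX) => [[_ UD _] _].
      by apply: UD => //; right.
    + have [XY|YX] := Ftot X Y FX FY.
      * apply: (UX Y) => //; case: (FQ Y FY) => [[_ UD _] _].
        by apply: UD => //; case: Xa => [/XY|]; [left | right].
      * apply: (UX X) => //; case: (FQ X FX) => [[_ UD _] _].
        by apply: UD => //; case: Yb => [/YX|]; [left | right].
  - move=> a b /UF [Ib|[X FX Xb]].
      by right; case: Ii => _ _ IM; apply: IM.
    apply: (UX X) => //; case: (FQ X FX) => [[_ _ UM] _].
    exact: UM.
have meets a : ~ U X a -> exists e, adjoin (U X) a (f ^+ e).
  move=> Xa; apply: boolp.contrapT => nof.
  have Ia b : U (adjoin (U X) a) b -> adjoin (U X) a b.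
    by case=> // Ib; apply: sub_adjoin; right.
  apply: (Xmax (adjoin (U X) a)); last split.
  - split=> [b Xb|sub]; first by apply: sub_adjoin; left.
    by apply: Xa; left; apply: sub; apply: mem_adjoin.
  - case: (adjoin_ideal a Ui) => M0 MD MM; split; first by left.
      by move=> b c /Ia ? /Ia ?; left; apply: MD.
    by move=> b c /Ia ?; left; apply: MM.
  - by move=> e /Ia Me; apply: nof; exists e.
exists (U X); split; last first.
- by move=> Xf; apply: (Uf 1%N); rewrite expr1.
- by right.
split=> //; first by move: (Uf 0%N); rewrite expr0.
move=> a b Xab; apply: boolp.contrapT => /boolp.not_orP [Xa Xb].
have [d [x [a' [Xx Ed]]]] := meets a Xa.
have [e [y [b' [Xy Ee]]]] := meets b Xb.
apply: (Uf (d + e)%N); case: (Ui) => _ UD UM.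
rewrite exprD Ed Ee mulrDr; apply: (UD); first exact: UM.
rewrite mulrDl; apply: UD; first exact: idealMr.
by rewrite mulrACA; apply: UM.
Qed.

(** The bound on the size of the quotient does not follow from the division
    identity when A has zero divisors, and the degree argument in
    [prime_extension] needs it. *)
Lemma pseudo_division (d q : {poly A}) : d != 0 ->
  exists e (a r : {poly A}), [/\ (lead_coef d ^+ e)%:P * q = a * d + r,
    (size r < size d)%N & (size a <= size q - (size d).-1)%N].
Proof.
move=> d0; set c := lead_coef d; set m := (size d).-1.
have szd : size d = m.+1 by rewrite /m prednK // size_poly_gt0.
have [n] := ubnP (size q); elim: n => // n IHn in q *; rewrite ltnS => szq.
have [lt_qm|le_mq] := leqP (size q) m.
  exists 0%N, 0, q; rewrite expr0 mul1r mul0r add0r szd ltnS size_poly0.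
  by split.
have szq1 : size q = (size q).-1.+1 by rewrite prednK // (leq_trans _ le_mq).
set l := (size q).-1 in szq1.
pose q' := c%:P * q - (lead_coef q)%:P * 'X^(l - m) * d.
have le_ml : (m <= l)%N by rewrite -ltnS -szq1.
have szq' : (size q' < size q)%N.
  rewrite szq1 ltnS; apply/leq_sizeP => i le_li; rewrite /q'.
  rewrite coefB !mul_polyC -scalerAl !coefZ coefXnM ltnNge.
  rewrite (leq_trans (leq_subr _ _) le_li) /=.
  have [->|ne_il] := eqVneq i l; first by rewrite subKn // mulrC subrr.
  have lt_li : (l < i)%N by rewrite ltn_neqAle eq_sym ne_il.
  rewrite (nth_default 0 (_ : size q <= i)%N) ?szq1 //.
  rewrite (nth_default 0 (_ : size d <= _)%N) ?mulr0 ?subr0 // szd.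
  by rewrite ltn_subRL subnK.
have [|e [a [r [E szr sza]]]] := IHn q'; first exact: leq_trans szq' szq.
exists e.+1, (a + (c ^+ e * lead_coef q)%:P * 'X^(l - m)), r; split=> //.
  rewrite mulrDl addrAC -E /q' mulrBr exprS polyCM polyCM !mulrA.
  by rewrite [c%:P * _]mulrC subrK.
apply: leq_trans (size_polyD _ _) _; rewrite geq_max; apply/andP; split.
  by apply: leq_trans sza _; apply: leq_sub2r; apply: ltnW.
rewrite mul_polyC (leq_trans (size_scale_leq _ _)) // size_polyXn.
by rewrite szq1 subSn.
Qed.

End Ideals.

(** * Extending a point along one variable *)

Section PrimeExtension.

Variables (A : comNzRingType) (P : {poly A} -> Prop) (Pp : prime_ideal P).

Let Pi : is_ideal P. Proof. by case: Pp. Qed.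

(** For P prime with contraction p, this says that q lies in p A[X], that is,
    that q reduces to 0 over the domain A/p. *)
Definition coefs_in (q : {poly A}) : Prop := forall i, P (q`_i)%:P.

Lemma coefs_in_mem q : coefs_in q -> P q.
Proof.
move=> Pq; rewrite -[q]coefK poly_def; apply: ideal_sum => // i.
by rewrite -mul_polyC; apply: idealMr.
Qed.

(** An element of M of least degree outside p A[X] has its leading coefficient
    outside p, since otherwise dropping the leading term would lower the degree.
    Pseudo-division by it then does over A what division by a generator of M
    does over the fraction field of A/p. *)
Lemma minimal_degree (M : {poly A} -> Prop) q :
    is_ideal M -> (forall x, P x -> M x) -> M q -> ~ coefs_in q ->
  exists w, [/\ M w, ~ P (lead_coef w)%:P
    & forall x, M x -> (size x < size w)%N -> coefs_in x].
Proof.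
move=> Mi PM; have [n] := ubnP (size q); elim: n => // n IHn in q *.
rewrite ltnS => szq Mq Nq.
have [[x [Mx szx Nx]]|noex] :=
  boolp.EM (exists x, [/\ M x, (size x < size q)%N & ~ coefs_in x]).
  by apply: (IHn x) => //; apply: leq_trans szx szq.
exists q; split=> // [Pl|x Mx szx]; last first.
  by apply: boolp.contrapT => Nx; apply: noex; exists x.
apply: noex; exists (q - (lead_coef q)%:P * 'X^((size q).-1)).
have q0 : q != 0.
  by apply/eqP=> q0; apply: Nq => i; rewrite q0 coef0; case: Pi.
split.
- by apply: idealB => //; apply: PM; apply: idealMr.
- rewrite -[ltnRHS]prednK ?size_poly_gt0 // ltnS; apply/leq_sizeP => i.
  rewrite coefB mul_polyC coefZ coefXn.
  rewrite leq_eqVlt => /orP [/eqP <-|lt_i]; first by rewrite eqxx mulr1 subrr.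
  rewrite gtn_eqF // mulr0 subr0 nth_default //.
  by rewrite -[size q]prednK ?size_poly_gt0.
- move=> N'; apply: Nq => i; have := N' i.
  rewrite coefB mul_polyC coefZ polyCB; apply: idealBl => //.
  by rewrite polyCM; apply: idealMr.
Qed.

(** Let p be the contraction of P to A.  If P = p A[X], any coefficient of f
    outside p will do, because k is infinite.  Otherwise let g have least degree
    in P outside p A[X]; over the fraction field of A/p it generates a maximal
    ideal, not containing f, so P + (f) contains an element b of A outside p.
    The product of b and the leading coefficient of g will do: X is sent to a
    root of the image of g, pseudo-division by g shows that all of P dies there,
    and b then keeps f from vanishing. *)
Lemma prime_extension f : ~ P f ->
  exists2 a, ~ P a%:P & forall (k : closedFieldType) (phi : {rmorphism A -> k}),
    (forall b, P b%:P -> phi b = 0) -> phi a != 0 ->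
    exists2 x, forall q, P q -> (map_poly phi q).[x] = 0
             & (map_poly phi f).[x] != 0.
Proof.
move=> Pf; have [_ P1 PM] := Pp.
have killed (k : closedFieldType) (phi : {rmorphism A -> k}) :
    (forall b, P b%:P -> phi b = 0) -> forall r, coefs_in r ->
    map_poly phi r = 0.
  by move=> phi0 r Pr; apply/polyP => i; rewrite coef_map coef0; apply: phi0.
have [[g0 [Pg0 Ng0]]|allP] := boolp.EM (exists q, P q /\ ~ coefs_in q); last first.
  have [i Pfi] : exists i, ~ P (f`_i)%:P.
    apply: boolp.contrapT => /boolp.forallNP no; apply: Pf.
    by apply: coefs_in_mem => i; apply: boolp.contrapT => /no.
  exists f`_i => // k phi phi0 fi0.
  have /closed_nonrootP [x fx] : map_poly phi f != 0.
    by apply: contra_neq fi0 => /polyP /(_ i); rewrite coef_map coef0.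
  exists x => // q Pq; rewrite (killed _ phi) ?horner0 // => j.
  by apply: boolp.contrapT => Nj; apply: allP; exists q; split.
have [g [Pg Lg gmin]] := minimal_degree Pi (fun x Px => Px) Pg0 Ng0.
have [w [Mw Lw wmin]] : exists w, [/\ adjoin P f w, ~ P (lead_coef w)%:P
    & forall x, adjoin P f x -> (size x < size w)%N -> coefs_in x].
  apply: (minimal_degree (q := f)).
  - exact: adjoin_ideal.
  - exact: sub_adjoin.
  - exact: mem_adjoin.
  - by move/coefs_in_mem.
have lead_neq0 (q : {poly A}) : ~ P (lead_coef q)%:P -> q != 0.
  by move=> Lq; apply/eqP => q0; apply: Lq; rewrite q0 lead_coef0; case: Pi.
have Mi := adjoin_ideal f Pi.
(* If w had positive degree, division by w would give c g = a w modulo p A[X]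
   with c outside p and deg a < deg g.  As P is prime it contains a or w.
   Minimality of g excludes a; and if w is in P then so is f. *)
have szw : size w = 1%N.
  apply/eqP; rewrite eqn_leq size_poly_gt0 lead_neq0 // andbT leqNgt.
  apply/negP => lt1w.
  have divw q : adjoin P f q -> exists e (a r : {poly A}),
     [/\ (lead_coef w ^+ e)%:P * q = a * w + r, coefs_in r
       & (size a <= size q - (size w).-1)%N].
    move=> Mq; have [e [a [r [E szr sza]]]] := pseudo_division q (lead_neq0 _ Lw).
    exists e, a, r; split=> //; apply: wmin => //.
    rewrite -[r](addKr (a * w)) -E addrC; apply: idealB => //.
      by case: Mi => _ _; apply.
    by case: Mi => _ _; apply.
  have [e [a [r [E Pr sza]]]] := divw g (sub_adjoin _ Pg).
  have Paw : P (a * w).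
    have -> : a * w = (lead_coef w ^+ e)%:P * g - r by rewrite E addrK.
    by apply: idealB (coefs_in_mem Pr) => //; case: Pi => _ _; apply.
  have [Pa|Pw] := PM _ _ Paw.
    have Na : coefs_in a.
      apply: gmin => //; apply: leq_ltn_trans sza _.
      by rewrite ltn_subrL size_poly_gt0 lead_neq0 // -subn1 subn_gt0 lt1w.
    have Ng : coefs_in ((lead_coef w ^+ e)%:P * g).
      rewrite E => i; rewrite coefD polyCD; case: (Pi) => _ ID _; apply: ID => //.
      rewrite coefM rmorph_sum; apply: ideal_sum => // j.
      by rewrite /= polyCM; apply: idealMr.
    have := Ng (size g).-1; rewrite coefCM polyCM => /PM [] //.
    by rewrite rmorphXn => /(prime_idealX Pp).
  have [e' [a' [r' [E' Pr' _]]]] := divw f (mem_adjoin _ Pi).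
  have : P ((lead_coef w ^+ e')%:P * f).
    rewrite E'; case: (Pi) => _ ID IM; apply: ID (coefs_in_mem Pr').
    exact: IM.
  by case/PM => //; rewrite rmorphXn => /(prime_idealX Pp).
have [b Ew] : exists b, w = b%:P by exists w`_0; apply: size1_polyC; rewrite szw.
have Nb : ~ P b%:P by move: Lw; rewrite Ew lead_coefC.
exists (lead_coef g * b) => [|k phi phi0].
  by rewrite polyCM => /PM [].
rewrite rmorphM mulf_eq0 negb_or => /andP [lg0 b0].
have szg : size (map_poly phi g) != 1%N.
  rewrite size_map_poly_id0 //; apply/negP => /eqP sz1; apply: Lg.
  have Eg : g = (g`_0)%:P by apply: size1_polyC; rewrite sz1.
  by rewrite Eg lead_coefC -Eg.
have /closed_rootP [x /eqP gx] := szg.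
have Px q : P q -> (map_poly phi q).[x] = 0.
  move=> Pq; have [e [a [r [E szr _]]]] := pseudo_division q (lead_neq0 _ Lg).
  have Pr : coefs_in r.
    apply: gmin => //; rewrite -[r](addKr (a * g)) -E addrC.
    by apply: idealB => //; case: (Pi) => _ _; apply.
  have := congr1 (fun q => (map_poly phi q).[x]) E.
  rewrite rmorphD !rmorphM /= map_polyC (killed _ phi phi0 r Pr) addr0 !hornerM /=.
  rewrite gx mulr0 hornerC rmorphXn => /eqP.
  by rewrite mulf_eq0 expf_eq0 (negPf lg0) andbF => /eqP.
exists x => //; move: Mw => [y [c [Py Ey]]].
apply: contraNneq b0 => fx.
have := congr1 (fun q => (map_poly phi q).[x]) Ey.
by rewrite Ew rmorphD rmorphM /= map_polyC !hornerE Px // fx mulr0 addr0 => ->.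
Qed.

End PrimeExtension.

(** * The Nullstellensatz *)

Section Nullstellensatz.

Variable k : closedFieldType.

Section LastVariable.

Variable n : nat.

Definition join_last (q : {poly {mpoly k[n]}}) : {mpoly k[n.+1]} :=
  (map_poly (@mwiden n k) q).['X_ord_max].

Lemma join_lastB : {morph join_last : p q / p - q}.
Proof. by move=> p q; rewrite /join_last rmorphB /= hornerD hornerN. Qed.

Lemma join_lastM : {morph join_last : p q / p * q}.
Proof. by move=> p q; rewrite /join_last rmorphM /= hornerM. Qed.

Lemma join_last1 : join_last 1 = 1.
Proof. by rewrite /join_last rmorph1 hornerC. Qed.

HB.instance Definition _ :=
  GRing.isZmodMorphism.Build _ _ join_last join_lastB.
HB.instance Definition _ := GRing.isMonoidMorphism.Build _ _ join_last
  (join_last1, join_lastM).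

(** Surjectivity is all that is needed of the isomorphism between
    k[x_1..x_n][X] and k[x_1..x_(n+1)]: prime ideals are pulled back along
    [join_last], and a zero of the pullback is a zero of the ideal. *)
Lemma join_last_surj p : exists q, join_last q = p.
Proof.
elim/mpolyind: p => [|c m p _ _ [q <-]]; first by exists 0; rewrite rmorph0.
suff [r Er] : exists r, join_last r = c *: 'X_[m].
  by exists (r + q); rewrite rmorphD /= Er.
have [r Er] : exists r, join_last r = 'X_[m].
  rewrite mpolyXE_id; apply: (big_ind (fun x => exists r, join_last r = x)).
  - by exists 1; rewrite rmorph1.
  - by move=> _ _ [r <-] [r' <-]; exists (r * r'); rewrite rmorphM.
  move=> i _; suff [r <-] : exists r, join_last r = 'X_i.
    by exists (r ^+ m i); rewrite rmorphXn.
  have [j ->|->] := unliftP ord_max i; last first.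
    by exists 'X; rewrite /join_last map_polyX hornerX.
  exists ('X_j)%:P; rewrite /join_last map_polyC hornerC /= mwidenX mnmwiden1.
  by congr 'X__; apply: val_inj; rewrite /= /bump leqNgt ltn_ord.
exists (c%:MP%:P * r); rewrite join_lastM Er /join_last map_polyC hornerC /=.
by rewrite mwidenC mul_mpolyC.
Qed.

Definition extend_point (v : 'I_n -> k) (x : k) (i : 'I_n.+1) : k :=
  oapp v x (unlift ord_max i).

Lemma meval_mwiden (v : 'I_n.+1 -> k) (p : {mpoly k[n]}) :
  (mwiden p).@[v] = p.@[v \o lift ord_max].
Proof.
rewrite [RHS]mevalE /mwiden /mmap raddf_sum; apply: eq_bigr => m _ /=.
rewrite mevalM mevalC rmorph_prod; congr (_ * _); apply: eq_bigr => i _.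
rewrite rmorphXn /= mevalXU; congr (v _ ^+ _); apply: val_inj.
by rewrite /= /bump leqNgt ltn_ord.
Qed.

Lemma meval_join_last v x q :
  (join_last q).@[extend_point v x] = (map_poly (meval v) q).[x].
Proof.
rewrite /join_last -horner_map /= mevalXU /extend_point unlift_none /=.
congr _.[_]; rewrite -map_poly_comp; apply: eq_map_poly => p /=.
by rewrite meval_mwiden; apply: meval_eq => i /=; rewrite liftK.
Qed.

End LastVariable.

(** Asking for a zero of P off the zeros of f, and not merely for a zero of P, is
    what makes the induction work: in one variable less, the part of f is
    played by the element a of [prime_extension]. *)
Lemma prime_zero n (P : {mpoly k[n]} -> Prop) f : prime_ideal P -> ~ P f ->
  exists2 v, forall p, P p -> p.@[v] = 0 & f.@[v] != 0.
Proof.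
elim: n P f => [|n IHn] P f Pp Pf; have [Pi P1 PM] := Pp; case: (Pi) => P0 PD PX.
  exists (fun=> 0) => [p|]; last first.
    apply/eqP => f0; apply: Pf; move: f0; rewrite [f]nvar0_mpolyC mevalC => ->.
    by rewrite mpolyC0.
  rewrite [p]nvar0_mpolyC mevalC => Pc; apply/eqP/negPn/negP => c0; apply: P1.
  by rewrite -mpolyC1 -(mulVf c0) mpolyCM; apply: PX.
pose Q q := P (join_last q).
have Qp : prime_ideal Q.
  split; rewrite /Q; first split.
  - by rewrite rmorph0.
  - by move=> a b Pa Pb; rewrite rmorphD; apply: PD.
  - by move=> a b Pb; rewrite rmorphM; apply: PX.
  - by rewrite rmorph1.
  - by move=> a b; rewrite rmorphM; apply: PM.
have [F EF] := join_last_surj f.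
have QF : ~ Q F by rewrite /Q EF.
have [a Qa ext] := prime_extension Qp QF.
have Qcp : prime_ideal (fun b => Q b%:P).
  case: Qp => [[Q0 QD QX] Q1 QM]; split; first split.
  - by rewrite polyC0.
  - by move=> b c Qb Qc; rewrite polyCD; apply: QD.
  - by move=> b c Qc; rewrite polyCM; apply: QX.
  - by rewrite polyC1.
  - by move=> b c; rewrite polyCM; apply: QM.
have [v vQ va] := IHn _ a Qcp Qa.
have [x xQ xF] := ext k (meval v) vQ va.
exists (extend_point v x); last by rewrite -EF meval_join_last.
move=> p; have [q <-] := join_last_surj p.
by rewrite meval_join_last; apply: xQ.
Qed.

Theorem nullstellensatz n (I : {mpoly k[n]} -> Prop) f : is_ideal I ->
    (forall v, (forall p, I p -> p.@[v] = 0) -> f.@[v] = 0) ->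
  radical I f.
Proof.
move=> Ii If; apply: boolp.contrapT => nf.
have [P [Pp IP Pf]] := exists_prime_avoiding Ii nf.
have [v vP] := prime_zero Pp Pf.
by rewrite If ?eqxx // => p /IP/vP.
Qed.

End Nullstellensatz.

(** * Spans *)

Definition submodule (R : pzRingType) (M : lmodType R) (T : M -> Prop) : Prop :=
  [/\ T 0, forall x y, T x -> T y -> T (x + y) & forall c x, T x -> T (c *: x)].

Section Spans.

Variables (R : pzRingType) (M : lmodType R).
Implicit Types (S T : M -> Prop).

Lemma mem_lin_span S x : S x -> lin_span S x.
Proof. by exists 1%N, (fun=> 1), (fun=> x); rewrite big_ord1 scale1r. Qed.

Lemma lin_span_submodule S : submodule (lin_span S).
Proof.
split.
- by exists 0%N, (fun=> 0), (fun=> 0); split; [case | rewrite big_ord0].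
- move=> _ _ [r [c [v [Sv ->]]]] [r' [c' [v' [Sv' ->]]]].
  exists (r + r')%N, (fun i => match split i with inl j => c j | inr j => c' j end),
    (fun i => match split i with inl j => v j | inr j => v' j end).
  split=> [i|]; first by case: (split i).
  rewrite big_split_ord /=; congr (_ + _); apply: eq_bigr => i _.
    by rewrite (unsplitK (inl _ i)).
  by rewrite (unsplitK (inr _ i)).
- move=> a _ [r [c [v [Sv ->]]]]; exists r, (fun i => a * c i), v; split=> //.
  by rewrite scaler_sumr; apply: eq_bigr => i _; rewrite scalerA.
Qed.

Lemma lin_span_min S T : submodule T -> (forall x, S x -> T x) ->
  forall x, lin_span S x -> T x.
Proof.
move=> [T0 TD TZ] ST _ [r [c [v [Sv ->]]]].
by apply: (big_ind T) => // i _; apply/TZ/ST.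
Qed.

End Spans.

Section SpansOverCommutative.

Variable A : comNzRingType.

Lemma ideal_gen_ideal (S : A -> Prop) : is_ideal (ideal_gen S).
Proof. by case: (@lin_span_submodule A A^o S). Qed.

Lemma submod_add_submodule (M : lmodType A) (S T : M -> Prop) :
  submodule S -> submodule T -> submodule (submod_add S T).
Proof.
move=> [S0 SD SZ] [T0 TD TZ]; split.
- by exists 0, 0; rewrite addr0.
- move=> _ _ [y [z [Sy Tz ->]]] [y' [z' [Sy' Tz' ->]]].
  by exists (y + y'), (z + z'); split; [apply: SD | apply: TD | rewrite addrACA].
- move=> c _ [y [z [Sy Tz ->]]].
  by exists (c *: y), (c *: z); split; [apply: SZ | apply: TZ | rewrite scalerDr].
Qed.

(** Used with b = 1, then with b in the first factor of an ideal product, this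
    reduces the inclusion of the product in a colon ideal to generators of the
    second factor. *)
Lemma colon_submodule (M : lmodType A) (S : M -> Prop) (b : A) (x : M) :
  submodule S -> @submodule A A^o (fun a => S ((b * a) *: x)).
Proof.
move=> [S0 SD SZ]; split=> [|a c Sa Sc|a c Sc].
- by rewrite mulr0 scale0r.
- by rewrite mulrDr scalerDl; apply: SD.
- change (S ((b * (a * c)) *: x)).
  by rewrite mulrCA -scalerA; apply: SZ.
Qed.

Lemma lin_span_colsP h s (g : 'I_s -> 'cV[A]_h) x :
  lin_span (fun v => exists j, v = g j) x <->
  exists y, x = (\matrix_(i, j) g j i 0) *m y.
Proof.
set G := \matrix_(i, j) _; split; last first.
  case=> y ->; exists s, (fun j => y j 0), g; split=> [j|]; first by exists j.
  apply/colP => i; rewrite mxE summxE; apply: eq_bigr => j _.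
  by rewrite !mxE mulrC.
apply: (lin_span_min (T := fun x => exists y, x = G *m y)).
  split=> [|_ _ [y ->] [z ->]|c _ [y ->]].
  - by exists 0; rewrite mulmx0.
  - by exists (y + z); rewrite mulmxDr.
  - by exists (c *: y); rewrite -scalemxAr.
move=> _ [j ->]; exists (delta_mx j 0).
by rewrite -colE; apply/colP => i; rewrite !mxE.
Qed.

Lemma ideal_smul_whole (I : A -> Prop) h (z : 'cV[A]_h) :
  (forall i, I (z i 0)) -> ideal_smul I (@whole _) z.
Proof.
move=> Iz; exists h, (fun=> 1), (fun i => z i 0 *: delta_mx i 0); split.
  by move=> i; exists (z i 0), (delta_mx i 0).
rewrite [LHS]matrix_sum_delta; apply: eq_bigr => i _.
by rewrite big_ord1 scale1r.
Qed.

End SpansOverCommutative.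

(** * Minors *)

Section Minors.

Variables (h s : nat).

Lemma monotone_reindex t m (f : 'I_t -> 'I_m) : injective f ->
  exists p : 'S_t, {homo (f \o p) : i j / (i < j)%N}.
Proof.
move=> f_inj; pose leI (a b : 'I_m) := (a <= b)%N.
have /tuple_permP [p Ep] :
  perm_eq (sort leI [tuple f i | i < t]) [tuple f i | i < t] by rewrite perm_sort.
exists p => i j lt_ij /=.
rewrite ltn_neqAle; apply/andP; split.
  by rewrite (inj_eq val_inj) (inj_eq f_inj) (inj_eq perm_inj) neq_ltn lt_ij.
have nthE (l : 'I_t) : nth (f i) (sort leI [tuple f i | i < t]) l = f (p l).
  by rewrite Ep -tnth_nth !tnth_mktuple.
have leI_sorted : sorted leI (sort leI [tuple f i | i < t]).
  by apply: sort_sorted => a b; apply: leq_total.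
have leI_trans : transitive leI by move=> a b c; apply: leq_trans.
have := sorted_ltn_nth leI_trans (f i) leI_sorted.
move=> /(_ i j); rewrite !inE size_sort size_tuple !ltn_ord !nthE.
exact.
Qed.

Variables (A : comNzRingType) (G : 'M[A]_(h, s)).

Lemma minor_not_inj t (f : 'I_t -> 'I_h) (g : 'I_t -> 'I_s) :
  ~~ injectiveb f -> \det (mxsub f g G) = 0.
Proof.
case/injectivePn => i [j ne_ij fij].
by apply: (determinant_alternate ne_ij) => l; rewrite !mxE fij.
Qed.

(** Rows and columns may be chosen with repetitions and in any order: the
    determinant is then 0, or a minor up to sign.  The bordered minors in
    Cramer's rule come in this form. *)
Lemma minor_in_ideal t (f : 'I_t -> 'I_h) (g : 'I_t -> 'I_s) :
  minor_ideal G t (\det (mxsub f g G)).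
Proof.
have [I0 _ IM] : is_ideal (minor_ideal G t) by apply: ideal_gen_ideal.
have [/injectiveP/monotone_reindex [p fp]|/minor_not_inj -> //] :=
  boolP (injectiveb f).
have [/injectiveP/monotone_reindex [q gq]|] := boolP (injectiveb g); last first.
  case/injectivePn => i [j ne_ij gij]; rewrite -det_tr.
  by rewrite (determinant_alternate ne_ij) // => l; rewrite !mxE gij.
have E : \det (mxsub (f \o p) (g \o q) G) =
    (-1) ^+ p * (\det (mxsub f g G) * (-1) ^+ q^-1%g).
  have -> : mxsub (f \o p) (g \o q) G = row_perm p (col_perm q (mxsub f g G)).
    by apply/matrixP => i j; rewrite !mxE.
  by rewrite row_permE col_permE !det_mulmx !det_perm.
have -> : \det (mxsub f g G) =
    (-1) ^+ p * (-1) ^+ q^-1%g * \det (mxsub (f \o p) (g \o q) G).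
  by rewrite E mulrACA -expr2 sqrr_sign mul1r mulrC -mulrA -expr2 sqrr_sign mulr1.
by apply: IM; apply: mem_lin_span; exists (f \o p), (g \o q).
Qed.

End Minors.

(** * Cramer's rule and bordered minors *)

Section Cramer.

Variables (A : idomainType) (h s t : nat).

(** Multiplying on the right by the block matrix (1, - adj M b; 0, det M) clears
    the upper right block and multiplies the determinant by det M; this
    factor is then cancelled, which uses that A is a domain. *)
Lemma det_bordered (M : 'M[A]_t) (b : 'cV_t) (r : 'rV_t) (d : 'M_1) :
  \det M != 0 ->
  \det (block_mx M b r d) = \det M * d 0 0 - (r *m \adj M *m b) 0 0.
Proof.
move=> M0; apply: (mulIf M0).
have := congr1 determinant
  (mulmx_block M b r d 1%:M (- (\adj M *m b)) 0 (\det M)%:M).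
rewrite det_mulmx det_ublock det1 mul1r det_scalar expr1 => ->.
rewrite !mulmx1 !mulmx0 !addr0 !mulmxN !mulmxA mul_mx_adj.
rewrite mul_scalar_mx mul_mx_scalar addNr det_lblock mulrC.
rewrite mul_mx_scalar; congr (_ * _).
by rewrite det_mx11 addrC mxE [X in X + _ = _]mxE [X in _ + X = _]mxE.
Qed.

Definition extend m (f : 'I_t -> 'I_m) (i : 'I_m) (x : 'I_(t + 1)) : 'I_m :=
  if split x is inl y then f y else i.

Variables (f : 'I_t -> 'I_h) (g : 'I_t -> 'I_s) (G : 'M[A]_(h, s)).

(** Let delta be the minor of G with rows f and columns g.  On a vector x this
    is delta x minus the combination of the columns g of G that agrees with
    delta x in the rows f; as a matrix over A, it commutes with evaluation. *)
Definition cramer_mx : 'M[A]_h :=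
  (\det (mxsub f g G))%:M
  - colsub g G *m \adj (mxsub f g G) *m rowsub f 1%:M.

Lemma cramer_mx_minor i j : \det (mxsub f g G) != 0 ->
  (cramer_mx *m G) i j = \det (mxsub (extend f i) (extend g j) G).
Proof.
move=> M0.
have -> : mxsub (extend f i) (extend g j) G =
    block_mx (mxsub f g G) (rowsub f (col j G)) (row i (colsub g G)) (G i j)%:M.
  rewrite -[LHS]submxK; congr block_mx; apply/matrixP => x y;
  by rewrite !mxE /extend ?(unsplitK (inl _ _)) ?(unsplitK (inr _ _)) ?ord1.
rewrite det_bordered // /cramer_mx mulmxBl mul_scalar_mx.
rewrite -(mulmxA _ (rowsub f 1%:M) G) -rowsubE -row_mul ![in LHS]mxE.
congr (_ - _); first by rewrite mxE.
rewrite mxE; apply: eq_bigr => l _; congr (_ * _); first by rewrite [RHS]mxE.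
by rewrite !mxE.
Qed.

Lemma cramer_mx_mod (x : 'cV_h) :
  exists y, \det (mxsub f g G) *: x = G *m y + cramer_mx *m x.
Proof.
exists (colsub g 1%:M *m (\adj (mxsub f g G) *m (rowsub f 1%:M *m x))).
rewrite /cramer_mx mulmxBl mul_scalar_mx !mulmxA mulmx_colsub mulmx1.
by rewrite addrC subrK.
Qed.

End Cramer.

(** * Evaluation at points *)

Section Evaluation.

Variables (k : closedFieldType) (n h s : nat).
Implicit Types (a : 'rV[k]_n) (c : 'cV[k]_h).

Lemma subst_const_vec c a : subst_vec (const_vec n c) a = c.
Proof. by apply/colP => i; rewrite !mxE mevalC. Qed.

Lemma subst_vec0 a : subst_vec (0 : 'cV[{mpoly k[n]}]_h) a = 0.
Proof. exact: raddf0. Qed.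

Lemma subst_vecD a (x y : 'cV[{mpoly k[n]}]_h) :
  subst_vec (x + y) a = subst_vec x a + subst_vec y a.
Proof. exact: raddfD. Qed.

Lemma subst_vecZ a p (x : 'cV[{mpoly k[n]}]_h) :
  subst_vec (p *: x) a = p.@[a 0] *: subst_vec x a.
Proof. exact: map_mxZ. Qed.

Lemma fiberP (g : 'I_s -> 'cV[{mpoly k[n]}]_h) E a c :
    (forall f, E f <-> lin_span (fun v => exists j, v = g j) f) ->
  fiber E a c <->
  exists y, c = map_mx (meval (a 0)) (\matrix_(i, j) g j i 0) *m y.
Proof.
move=> hE; set G := \matrix_(i, j) _; split; last first.
  case=> y ->; exists s, (fun j => y j 0), (fun j => subst_vec (g j) a); split.
    move=> j; exists (g j); split=> //; apply/hE/mem_lin_span.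
    by exists j.
  apply/colP => i; rewrite mxE summxE; apply: eq_bigr => j _.
  by rewrite !mxE mulrC.
apply: (lin_span_min (T := fun c => exists y, c = map_mx (meval (a 0)) G *m y)).
  split=> [|_ _ [y ->] [z ->]|b _ [y ->]].
  - by exists 0; rewrite mulmx0.
  - by exists (y + z); rewrite mulmxDr.
  - by exists (b *: y); rewrite -scalemxAr.
move=> _ [f [/hE/lin_span_colsP [y ->] ->]].
by exists (map_mx (meval (a 0)) y); rewrite -map_mxM.
Qed.

Lemma minor_ideal_meval t (G : 'M[{mpoly k[n]}]_(h, s)) (v : 'I_n -> k) :
  (forall p, minor_ideal G t p -> p.@[v] = 0) <->
  (forall (f : 'I_t -> 'I_h) (g : 'I_t -> 'I_s),
     \det (mxsub f g (map_mx (meval v) G)) = 0).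
Proof.
split=> [I0 f g|M0].
  by rewrite -map_mxsub det_map_mx; apply/I0/minor_in_ideal.
apply: (@lin_span_min _ {mpoly k[n]}^o _ (fun p => p.@[v] = 0)).
  split=> [|p q /= p0 q0|p q /= q0]; first exact: meval0.
    by rewrite mevalD p0 q0 addr0.
  by rewrite mevalM q0 mulr0.
by move=> _ [f [g [_ _ ->]]]; rewrite -det_map_mx map_mxsub.
Qed.

Lemma subst_ideal_smul (I : {mpoly k[n]} -> Prop) S a (z : 'cV[{mpoly k[n]}]_h) :
  (forall p, I p -> p.@[a 0] = 0) -> ideal_smul I S z -> subst_vec z a = 0.
Proof.
move=> I0; apply: (lin_span_min (T := fun z => subst_vec z a = 0)).
  split=> [|x y x0 y0|p x x0]; first exact: subst_vec0.
    by rewrite subst_vecD x0 y0 addr0.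
  by rewrite subst_vecZ x0 scaler0.
by move=> _ [p [f [/I0 p0 _ ->]]]; rewrite subst_vecZ p0 scale0r.
Qed.

Lemma radical_meval (I : {mpoly k[n]} -> Prop) (v : 'I_n -> k) p :
  (forall q, I q -> q.@[v] = 0) -> radical I p -> p.@[v] = 0.
Proof.
move=> I0 [e /I0]; rewrite rmorphXn => /eqP.
by rewrite expf_eq0 => /andP[_ /eqP].
Qed.

(** The least t for which all (t+1)-minors vanish exists because an
    (h+1)-minor repeats a row. *)
Lemma exists_last_minor (M : 'M[k]_(h, s)) : exists t f g,
  \det (mxsub f g M : 'M_t) != 0 /\
  forall (f : 'I_t.+1 -> 'I_h) (g : 'I_t.+1 -> 'I_s), \det (mxsub f g M) = 0.
Proof.
apply: boolp.contrapT => nolast.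
have big t : exists f g, \det (mxsub f g M : 'M_t) != 0.
  elim: t => [|t [f [g fg0]]].
    exists (widen_ord (leq0n h)), (widen_ord (leq0n s)).
    by rewrite det_mx00 oner_neq0.
  apply: boolp.contrapT => none; apply: nolast; exists t, f, g; split=> // f' g'.
  by apply/eqP/negPn/negP => nz; apply: none; exists f', g'.
have [f [g]] := big h.+1; rewrite minor_not_inj ?eqxx //.
by apply/negP => /injectiveP/leq_card; rewrite !card_ord ltnn.
Qed.

(** An equation of V that is nonzero at a may be a constant (if V is empty);
    multiplying it by a coordinate of a that is nonzero makes it vanish at the
    origin as well. *)
Lemma exists_nonzero_off_variety (V : 'rV[k]_n -> Prop) a :
  projective_variety V -> a != 0 -> ~ V a ->
  exists2 p, defining_ideal V p & p.@[a 0] != 0.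
Proof.
move=> [S [_ VS]] a0 Va.
have [p Sp pa] : exists2 p, S p & p.@[a 0] != 0.
  apply: boolp.contrapT => none; apply/Va/VS => // p Sp.
  by apply/eqP/negPn/negP => nz; apply: none; exists p.
have [i ai] : exists i, a 0 i != 0.
  apply/existsP; rewrite -negb_forall; apply: contra a0 => /forallP az.
  by apply/eqP/rowP => i; rewrite mxE; apply/eqP.
exists ('X_i * p); last by rewrite mevalM mevalXU mulf_neq0.
move=> b; rewrite mevalM mevalXU; case=> [->|[b0 /(VS b b0) bS]].
  by rewrite mxE mul0r.
by rewrite bS ?mulr0.
Qed.

End Evaluation.

Theorem corollary1p4 (k : closedFieldType) (d m : nat) (hd : (1 <= d)%N)
    (hm : (1 <= m)%N) (V : 'rV[k]_(d * m) -> Prop)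
    (hV : projective_variety V)
    (h s : nat) (hh : (1 <= h)%N)
    (g : 'I_s -> 'cV[{mpoly k[d * m]}]_h)
    (E : 'cV[{mpoly k[d * m]}]_h -> Prop)
    (hEgen : forall f, E f <-> lin_span (fun v => exists j, v = g j) f)
    (hEgr : graded E)
    (J : {mpoly k[d * m]} -> Prop) (hJ : is_ideal J)
    (hJV : forall p, radical J p <-> defining_ideal V p) :
  let I := minor_ideal (\matrix_(i, j) g j i 0) in
  let F := @whole 'cV[{mpoly k[d * m]}]_h in
  forall c : 'cV[k]_h,
    core V E c <->
    (forall t : nat, (1 <= t)%N ->
       colon (submod_add E (ideal_smul (radical (I t)) F))
         (ideal_mul J (I (t - 1)%N)) (const_vec (d * m) c)).
Proof.
set G := \matrix_(i, j) g j i 0 => I F c.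
have hE := hEgen; have Esub : submodule E.
  have [E0 ED EZ] := lin_span_submodule (fun v => exists j, v = g j).
  split=> [|x y /hE Ex /hE Ey|p x /hE Ex]; apply/hE => //; first exact: ED.
  exact: EZ.
split=> [corec [//|t] _|colonc a a0 Va]; last first.
  have [t [f [f' [nz last]]]] := exists_last_minor (map_mx (meval (a 0)) G).
  have [p Vp pa] := exists_nonzero_off_variety hV a0 Va.
  have [e Jp] : radical J p by apply/hJV.
  pose q := p ^+ e * \det (mxsub f f' G).
  have q0 : q.@[a 0] != 0.
    rewrite mevalM mulf_neq0 //; last by rewrite -det_map_mx map_mxsub.
    by rewrite rmorphXn expf_neq0.
  have [|y [z [Ey Iz Eq]]] := colonc t.+1 isT q.
    apply: mem_lin_span; exists (p ^+ e), (\det (mxsub f f' G)); split=> //.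
    by rewrite subn1; apply: minor_in_ideal.
  have z0 : subst_vec z a = 0.
    apply: subst_ideal_smul Iz => r; apply: radical_meval.
    exact/minor_ideal_meval.
  have := congr1 (fun x => subst_vec x a) Eq.
  rewrite subst_vecZ subst_vecD z0 addr0 subst_const_vec => Ec.
  have [F0 FD FZ] :=
    lin_span_submodule (fun w => exists f, E f /\ w = subst_vec f a).
  rewrite -[c]scale1r -(mulVf q0) -scalerA Ec; apply: FZ.
  by apply: mem_lin_span; exists y.
(* Bordering adds one row after the t others, hence t + 1 rather than t.+1. *)
rewrite subn1 -[t.+1.-1]/t -(addn1 t).
set T := submod_add _ _.
have Tsub : submodule T by apply/submod_add_submodule/lin_span_submodule.
suff gen q f f' : J q -> T ((q * \det (mxsub f f' G : 'M_t)) *: const_vec _ c).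
  move=> b; have [T0 TD TZ] := Tsub.
  have -> : T (b *: const_vec (d * m) c) = T ((1 * b) *: const_vec (d * m) c).
    by rewrite mul1r.
  apply: (lin_span_min (colon_submodule 1 (const_vec _ c) Tsub)).
  move=> _ [q [r [Jq Ir ->]]]; rewrite mul1r; move: r Ir.
  apply: (lin_span_min (colon_submodule q (const_vec _ c) Tsub)).
  by move=> _ [f [f' [_ _ ->]]]; apply: gen.
move=> Jq; have [->|nz] := eqVneq (\det (mxsub f f' G)) 0.
  by case: Tsub => T0 _ _; rewrite mulr0 scale0r.
set K := cramer_mx f f' G.
have [y Ey] := cramer_mx_mod f f' G (const_vec _ c).
rewrite -scalerA Ey scalerDr; exists (q *: (G *m y)), (q *: (K *m const_vec _ c)).
split=> //.
  by rewrite scalemxAr; apply/hE/lin_span_colsP; exists (q *: y).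
apply: ideal_smul_whole => i; apply: nullstellensatz => [|v Iv].
  exact: ideal_gen_ideal.
pose a : 'rV[k]_(d * m) := \row_j v j.
have av : a 0 =1 v by move=> j; rewrite mxE.
rewrite mxE mevalM.
have [Va|Va] := boolp.EM (affine_cone V a).
  rewrite -(meval_eq _ av) (_ : q.@[a 0] = 0) ?mul0r //.
  by apply: (proj1 (hJV q)) => //; exists 1%N; rewrite expr1.
have [w Ew] : exists w, c = map_mx (meval v) G *m w.
  have [||w ->] := proj1 (fiberP a c hE) (corec a _ _).
  - by apply/eqP => a0; apply: Va; left.
  - by move=> aV; apply: Va; have [->|a0] := eqVneq a 0; [left | right].
  exists w; congr (_ *m _); apply/matrixP => i' j; rewrite !mxE.
  exact: meval_eq.
suff Kc0 : map_mx (meval v) (K *m const_vec _ c) = 0.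
  by move/colP: Kc0 => /(_ i); rewrite [LHS]mxE => ->; rewrite mxE mulr0.
rewrite map_mxM (_ : map_mx _ (const_vec _ c) = c); last first.
  by apply/colP => i'; rewrite !mxE /= mevalC.
rewrite Ew mulmxA -map_mxM (_ : map_mx _ (K *m G) = 0) ?mul0mx //.
apply/matrixP => i' j; rewrite mxE cramer_mx_minor // [RHS]mxE.
exact/Iv/minor_in_ideal.
Qed.
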